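(* Let $C^\infty(\mathbb{R}^n,o)$ be the ring of germs of smooth functions at the origin $o\in\mathbb{R}^n$, let $J\subset(x)\subset C^\infty(\mathbb{R}^n,o)$ be an ideal whose zero-set germ satisfies $V(J)\neq\{o\}$, and let $\xi\in \mathrm{Der}_\mathbb{R}(C^\infty(\mathbb{R}^n,o)/J)$ be a derivation, presented by $\xi=\sum_{i=1}^n\xi_i(x)\frac{\partial}{\partial x_i}\in \mathrm{Der}_\mathbb{R}(C^\infty(\mathbb{R}^n,o))$ with $\xi(J)\subseteq J$. If $\xi|_{V(J)}\neq0$ (i.e. at least one of the $\xi_i$ does not vanish identically on the set-germ $V(J)$), then the operator $e^\xi$ does not act on $C^\infty(\mathbb{R}^n,o)/J$. Namely, there exist a function germ $f\in C^\infty(\mathbb{R}^n,o)$ and a sequence of points $z_d\in V(J)$ converging to $o$ such that the series $e^\xi f|_{z_d}=\sum_{j\ge0}\frac{1}{j!}(\xi^jf)(z_d)$ diverges for each $d$.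
   Context: $x=(x_1,\dots,x_n)$ are the coordinates on $\mathbb{R}^n$, $(x)$ is the maximal ideal of germs vanishing at $o$, and $V(J)\subseteq(\mathbb{R}^n,o)$ is the closed subgerm defined by $J$. The condition $V(J)\ne\{o\}$ means that any representative of $V(J)$ contains more than one point. The operator is defined by the Taylor expansion $e^\xi:=\sum_{j\ge0}\frac{\xi^j}{j!}$. Evaluations at points $z_d$ are of representatives of the germs on a small neighborhood of $o$. *)

(* Defs.v *)
From HB Require Import structures.
From mathcomp Require Import all_boot all_order all_algebra.
From mathcomp Require Import generic_quotient ring_quotient.
From mathcomp Require Import all_classical all_reals all_analysis.
Import Order.TTheory GRing.Theory Num.Theory.
Import numFieldNormedType.Exports.

Set Implicit Arguments.
Unset Strict Implicit.
Unset Printing Implicit Defensive.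

Local Open Scope classical_set_scope.
Local Open Scope ring_scope.
Local Open Scope quotient_scope.

Section SmoothFunctions.
Context {R : realType} {n : nat}.
Implicit Types (f g : 'rV[R]_n -> R) (U : set 'rV[R]_n) (s : seq 'I_n).

Definition pd (i : 'I_n) f : 'rV[R]_n -> R := fun x => 'D_(delta_mx 0 i) f x.

Definition pds s f : 'rV[R]_n -> R := foldr pd f s.

(* For open U this is f \in C^\infty(U): all iterated partial derivatives
   exist and are continuous at the points of U. *)
Definition smooth_on U f : Prop :=
  forall s x, U x ->
    {for x, continuous (pds s f)} /\
    forall i, derivable (pds s f) x (delta_mx 0 i).

Definition smooth_near0 f : Prop :=
  exists2 U, open_nbhs (0 : 'rV[R]_n) U & smooth_on U f.

Definition vector_field (X : 'I_n -> 'rV[R]_n -> R) f : 'rV[R]_n -> R :=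
  fun x => \sum_(i < n) X i x * pd i f x.

Local Notation "''e_' i" := (delta_mx 0 i : 'rV[R]_n).

Let C k U f := forall s x, (size s <= k)%N -> U x ->
    {for x, continuous (pds s f)} /\ forall i, derivable (pds s f) x 'e_i.

Let smoothC U f : smooth_on U f <-> forall k, C k U f.
Proof.
split=> [H k s x _ Ux|H s x Ux]; first exact: H.
exact: (H (size s)).
Qed.

Let C0 U f : C 0 U f <-> forall x, U x ->
    {for x, continuous f} /\ forall i, derivable f x 'e_i.
Proof.
by split=> [H x Ux|H [|//] x _ Ux]; [exact: (H [::])|exact: H].
Qed.

Let CS k U f : C k.+1 U f <-> (C 0 U f /\ forall i, C k U (pd i f)).
Proof.
split=> [H|[H0 H] s x].
  split=> [s x s0|i s x sk] Ux; first by apply: H => //; rewrite (leq_trans s0).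
  have := H (rcons s i) x; rewrite size_rcons ltnS => /(_ sk Ux).
  by rewrite /pds foldr_rcons.
case/lastP: s => [|s i]; first by move=> _ Ux; exact: H0.
rewrite size_rcons ltnS => sk Ux.
by have := H i s x sk Ux; rewrite /pds foldr_rcons.
Qed.

Let Cle k l U f : (k <= l)%N -> C l U f -> C k U f.
Proof. by move=> kl H s x sk; apply: H; apply: leq_trans kl. Qed.

Lemma eq_on_near U f g x : open U -> {in U, f =1 g} -> U x ->
  \forall y \near x, f y = g y.
Proof.
move=> oU fg Ux; have /= UU : nbhs x U by apply: open_nbhs_nbhs.
by apply: filterS UU => y Uy; apply: fg; rewrite inE.
Qed.

Lemma pd_eq_on U f g i : open U -> {in U, f =1 g} -> {in U, pd i f =1 pd i g}.
Proof.
move=> oU fg x; rewrite inE => Ux; apply: near_eq_derive.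
exact: eq_on_near fg Ux.
Qed.

Let C_eq k U f g : open U -> {in U, f =1 g} -> C k U f -> C k U g.
Proof.
move=> oU.
have base h1 h2 : {in U, h1 =1 h2} -> C 0 U h1 -> C 0 U h2.
  move=> fg /C0 H; apply/C0 => x Ux; have [cf df] := H x Ux.
  have nfg : \forall y \near x, h1 y = h2 y by exact: eq_on_near fg Ux.
  split=> [|i]; last by apply: near_eq_derivable (df i).
  rewrite /prop_for /continuous_at -fg ?inE//.
  by apply: cvg_trans cf; exact: near_eq_cvg nfg.
elim: k f g => [|k IH] f g fg; first exact: base.
move=> /CS[f0 fk]; apply/CS; split; first exact: base f0.
by move=> i; apply: IH (fk i); apply: pd_eq_on.
Qed.

Let C_add k U f g : open U -> C k U f -> C k U g -> C k U (f \+ g).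
Proof.
move=> oU; have base h1 h2 : C 0 U h1 -> C 0 U h2 -> C 0 U (h1 \+ h2).
  move=> /C0 Hf /C0 Hg; apply/C0 => x Ux; have [cf df] := Hf x Ux; have [cg dg] := Hg x Ux.
  by split=> [|i]; [exact: continuousD|exact: derivableD].
elim: k f g => [|k IH] f g; first exact: base.
move=> /CS[f0 fk] /CS[g0 gk]; apply/CS; split; first exact: base.
move=> i; apply: C_eq (IH _ _ (fk i) (gk i)) => // x; rewrite inE => Ux.
move: f0 g0; rewrite !C0 => /(_ x Ux)[_ df] /(_ x Ux)[_ dg].
by rewrite /pd deriveD.
Qed.

Let C_mul k U f g : open U -> C k U f -> C k U g -> C k U (f \* g).
Proof.
move=> oU; have base h1 h2 : C 0 U h1 -> C 0 U h2 -> C 0 U (h1 \* h2).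
  move=> /C0 Hf /C0 Hg; apply/C0 => x Ux; have [cf df] := Hf x Ux; have [cg dg] := Hg x Ux.
  by split=> [|i]; [exact: continuousM|exact: derivableM].
elim: k f g => [|k IH] f g; first exact: base.
move=> Cf Cg; have /CS[f0 fk] := Cf; have /CS[g0 gk] := Cg.
apply/CS; split; first exact: base.
move=> i.
have H1 : C k U (f \* pd i g) := IH _ _ (Cle (leqnSn k) Cf) (gk i).
have H2 : C k U (g \* pd i f) := IH _ _ (Cle (leqnSn k) Cg) (fk i).
apply: C_eq (C_add oU H1 H2) => // x; rewrite inE => Ux.
move: f0 g0; rewrite !C0 => /(_ x Ux)[_ df] /(_ x Ux)[_ dg].
by rewrite /pd deriveM.
Qed.

Lemma smooth_on_eq U f g :
  open U -> {in U, f =1 g} -> smooth_on U f -> smooth_on U g.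
Proof. by move=> oU fg /smoothC H; apply/smoothC => k; apply: C_eq (H k). Qed.

Lemma smooth_onD U f g :
  open U -> smooth_on U f -> smooth_on U g -> smooth_on U (f \+ g).
Proof.
by move=> oU /smoothC Hf /smoothC Hg; apply/smoothC => k; apply: C_add.
Qed.

Lemma smooth_onM U f g :
  open U -> smooth_on U f -> smooth_on U g -> smooth_on U (f \* g).
Proof.
by move=> oU /smoothC Hf /smoothC Hg; apply/smoothC => k; apply: C_mul.
Qed.

Lemma smooth_on_pd U f i : smooth_on U f -> smooth_on U (pd i f).
Proof. by move=> /smoothC H; apply/smoothC => k; have /CS[_] := H k.+1. Qed.

Lemma pds_cst s (c : R) : pds s (cst c) = cst (if nilp s then c else 0).
Proof.
elim: s => //= i s ->; apply/funext => x.
by rewrite /pd derive_cst.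
Qed.

Lemma smooth_on_cst U (c : R) : smooth_on U (cst c).
Proof.
move=> s x _; rewrite pds_cst; split; first exact: cst_continuous.
by move=> i; apply: derivable_cst.
Qed.

Lemma smooth_onS U V f : V `<=` U -> smooth_on U f -> smooth_on V f.
Proof. by move=> VU H s x /VU; apply: H. Qed.

Lemma open_nbhsI (x : 'rV[R]_n) U V :
  open_nbhs x U -> open_nbhs x V -> open_nbhs x (U `&` V).
Proof. by move=> [? ?] [? ?]; split; [apply: openI|split]. Qed.

Definition smooth_near0_pred : {pred 'rV[R]_n -> R} :=
  fun f => `[< smooth_near0 f >].

Lemma smooth_near0_predP f :
  reflect (smooth_near0 f) (f \in smooth_near0_pred).
Proof. exact: asboolP. Qed.

Lemma smooth_near0_cst (c : R) : smooth_near0 (cst c).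
Proof.
exists setT; last exact: smooth_on_cst.
by split; [exact: openT|].
Qed.

Lemma smooth_near0D f g :
  smooth_near0 f -> smooth_near0 g -> smooth_near0 (f \+ g).
Proof.
move=> [U oU fU] [V oV gV]; exists (U `&` V); first exact: open_nbhsI.
apply: smooth_onD; first exact: (open_nbhsI oU oV).1.
  by apply: smooth_onS fU => x [].
by apply: smooth_onS gV => x [].
Qed.

Lemma smooth_near0M f g :
  smooth_near0 f -> smooth_near0 g -> smooth_near0 (f \* g).
Proof.
move=> [U oU fU] [V oV gV]; exists (U `&` V); first exact: open_nbhsI.
apply: smooth_onM; first exact: (open_nbhsI oU oV).1.
  by apply: smooth_onS fU => x [].
by apply: smooth_onS gV => x [].
Qed.

Lemma smooth_near0_pd f i : smooth_near0 f -> smooth_near0 (pd i f).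
Proof. by move=> [U oU fU]; exists U; [exact: oU|exact: smooth_on_pd fU]. Qed.

Lemma smooth_subring_closed : subring_closed smooth_near0_pred.
Proof.
split=> [|f g|f g]; first by apply/smooth_near0_predP/smooth_near0_cst.
- move=> /smooth_near0_predP sf /smooth_near0_predP sg.
  apply/smooth_near0_predP.
  have -> : f - g = f \+ (cst (-1) \* g).
    by apply/funext => x /=; rewrite mulN1r.
  exact: smooth_near0D sf (smooth_near0M (smooth_near0_cst (-1)) sg).
- move=> /smooth_near0_predP sf /smooth_near0_predP sg.
  by apply/smooth_near0_predP; exact: smooth_near0M.
Qed.

HB.instance Definition _ :=
  GRing.isSubringClosed.Build _ smooth_near0_pred smooth_subring_closed.

End SmoothFunctions.

Record smooth_fun (R : realType) (n : nat) := SmoothFun {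
  smooth_fun_val :> 'rV[R]_n -> R;
  _ : smooth_fun_val \in smooth_near0_pred }.

HB.instance Definition _ R n := [isSub for @smooth_fun_val R n].
HB.instance Definition _ R n := [Choice of smooth_fun R n by <:].
HB.instance Definition _ R n :=
  [SubChoice_isSubComNzRing of smooth_fun R n by <:].

Section Germs.
Context {R : realType} {n : nat}.

Lemma smooth_funP (f : smooth_fun R n) : smooth_near0 f.
Proof. exact/smooth_near0_predP/valP. Qed.

Definition smooth_fun_cst (c : R) : smooth_fun R n :=
  SmoothFun (introT (smooth_near0_predP _) (smooth_near0_cst c)).

Definition smooth_fun_pd (i : 'I_n) (f : smooth_fun R n) : smooth_fun R n :=
  SmoothFun (introT (smooth_near0_predP _) (smooth_near0_pd i (smooth_funP f))).

Definition null_germ : {pred smooth_fun R n} :=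
  fun f => `[< \forall x \near (0 : 'rV[R]_n), f x = 0 >].

Lemma null_germ_closed : idealr_closed null_germ.
Proof.
split.
- by apply/asboolP; near=> x.
- apply/asboolP => /nbhs_singleton /eqP.
  by rewrite oner_eq0.
- move=> a f g /asboolP f0 /asboolP g0; apply/asboolP.
  near=> x.
  have -> : (a * f + g : smooth_fun R n) x = a x * f x + g x by [].
  have -> : f x = 0 by near: x.
  have -> : g x = 0 by near: x.
  by rewrite mulr0 addr0.
Unshelve. all: by end_near. Qed.

HB.instance Definition _ := isIdealr.Build _ null_germ null_germ_closed.

End Germs.

(* C^\infty(R^n,o): functions smooth near the origin, modulo those that
   vanish near the origin. *)
Definition germ (R : realType) (n : nat) := {ideal_quot (@null_germ R n)}.

HB.instance Definition _ R n := GRing.ComNzRing.on (germ R n).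
HB.instance Definition _ R n := NzRingQuotient.on (germ R n).

(* c is the structure map that makes A an R-algebra. *)
Definition is_derivation (R : realType) (A : comNzRingType) (c : R -> A)
    (D : A -> A) : Prop :=
  [/\ {morph D : a b / a + b},
      forall k a, D (c k * a) = c k * D a
    & forall a b, D (a * b) = D a * b + a * D b].

Section GermTheory.
Context {R : realType} {n : nat}.
Implicit Types (g h : germ R n) (Z U : set 'rV[R]_n).

Definition germ_fun g : 'rV[R]_n -> R := (repr g : smooth_fun R n).

(* The function F, taken on U, is a representative of the germ g. *)
Definition germ_rep U (F : 'rV[R]_n -> R) g : Prop :=
  smooth_on U F /\ \forall x \near (0 : 'rV[R]_n), F x = germ_fun g x.

Definition germ_eval0 g : R := germ_fun g 0.

Definition germ_cst (c : R) : germ R n := \pi_(germ R n) (smooth_fun_cst c).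

Definition germ_pd (i : 'I_n) g : germ R n := \pi_(germ R n) (smooth_fun_pd i (repr g)).

Definition germ_vector_field (xi : 'I_n -> germ R n) g : germ R n :=
  \sum_(i < n) xi i * germ_pd i g.

Lemma germ_funP g : smooth_near0 (germ_fun g).
Proof. exact: smooth_funP. Qed.

Lemma eq_germP g h :
  (\forall x \near (0 : 'rV[R]_n), germ_fun g x = germ_fun h x) <-> g = h.
Proof.
split=> [gh|->]; last by near=> x.
rewrite -[g]reprK -[h]reprK; apply/eqP.
rewrite -Quotient.idealrBE; apply/asboolP; near=> x.
have -> : (repr g - repr h : smooth_fun R n) x = germ_fun g x - germ_fun h x.
  by [].
by apply/eqP; rewrite subr_eq0; apply/eqP; near: x.
Unshelve. all: by end_near. Qed.

Lemma germ_fun_pi (f : smooth_fun R n) :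
  \forall x \near (0 : 'rV[R]_n), germ_fun (\pi f : germ R n) x = f x.
Proof.
have /eqP := reprK (\pi f : germ R n).
rewrite -Quotient.idealrBE => /asboolP H; near=> x.
apply/eqP; rewrite -subr_eq0; apply/eqP.
by have : (repr (\pi f : germ R n) - f : smooth_fun R n) x = 0 by near: x.
Unshelve. all: by end_near. Qed.

Lemma germ_funD g h : \forall x \near (0 : 'rV[R]_n),
  germ_fun (g + h) x = germ_fun g x + germ_fun h x.
Proof.
have := germ_fun_pi (repr g + repr h).
have -> : \pi_(germ R n) (repr g + repr h) = g + h.
  by rewrite -{2}[g]reprK -{2}[h]reprK; exact: (@pi_addr _ _ _ _ _ (germ R n)).
by [].
Qed.

Lemma germ_funM g h : \forall x \near (0 : 'rV[R]_n),
  germ_fun (g * h) x = germ_fun g x * germ_fun h x.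
Proof.
have := germ_fun_pi (repr g * repr h).
have -> : \pi_(germ R n) (repr g * repr h) = g * h.
  by rewrite -{2}[g]reprK -{2}[h]reprK;
    exact: (@pi_mulr _ _ _ _ _ _ _ (germ R n)).
by [].
Qed.

Lemma germ_fun_cst c : \forall x \near (0 : 'rV[R]_n),
  germ_fun (germ_cst c) x = c.
Proof. exact: germ_fun_pi. Qed.

Lemma germ_fun_pd i g : \forall x \near (0 : 'rV[R]_n),
  germ_fun (germ_pd i g) x = pd i (germ_fun g) x.
Proof. exact: germ_fun_pi. Qed.

Lemma germ_fun_sum (F : 'I_n -> germ R n) :
  \forall x \near (0 : 'rV[R]_n),
    germ_fun (\sum_(i < n) F i) x = \sum_(i < n) germ_fun (F i) x.
Proof.
elim: (index_enum _) => [|i r IH].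
  have := germ_fun_pi 0.
  have -> : \pi_(germ R n) 0 = 0 by exact: (@pi_zeror _ _ _ _ _ (germ R n)).
  by move=> H; near=> x; rewrite !big_nil; near: x.
near=> x; rewrite !big_cons; have <- : germ_fun (\sum_(j <- r) F j) x =
  \sum_(j <- r) germ_fun (F j) x by near: x.
by near: x; exact: germ_funD.
Unshelve. all: by end_near. Qed.

Lemma germ_rep_vector_field U (X : 'I_n -> 'rV[R]_n -> R) F xi g :
  open_nbhs (0 : 'rV[R]_n) U ->
  (forall i, germ_rep U (X i) (xi i)) -> germ_rep U F g ->
  germ_rep U (vector_field X F) (germ_vector_field xi g).
Proof.
move=> [oU U0] repX [sF Fg]; split.
  have sum s : smooth_on U (fun x => \sum_(i <- s) X i x * pd i F x).
    elim: s => [|i s IH].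
      have -> : (fun x => \sum_(i <- [::]) X i x * pd i F x) = cst 0.
        by apply/funext => x; rewrite big_nil.
      exact: smooth_on_cst.
    have -> : (fun x => \sum_(j <- i :: s) X j x * pd j F x) =
        (X i \* pd i F) \+ (fun x => \sum_(j <- s) X j x * pd j F x).
      by apply/funext => x; rewrite big_cons.
    have sX := smooth_onM oU (repX i).1 (smooth_on_pd i sF).
    exact: smooth_onD oU sX IH.
  exact: sum.
have Xg i : \forall x \near (0 : 'rV[R]_n),
    X i x * pd i F x = germ_fun (xi i * germ_pd i g) x.
  have /nbhs_interior Fg' := Fg.
  near=> x.
  have -> : germ_fun (xi i * germ_pd i g) x =
      germ_fun (xi i) x * germ_fun (germ_pd i g) x.
    by near: x; exact: germ_funM.
  have -> : germ_fun (germ_pd i g) x = pd i (germ_fun g) x.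
    by near: x; exact: germ_fun_pd.
  have -> : X i x = germ_fun (xi i) x by near: x; exact: (repX i).2.
  congr (_ * _); apply: near_eq_derive.
  by near: x.
near=> x.
have -> : germ_fun (germ_vector_field xi g) x =
    \sum_(i < n) germ_fun (xi i * germ_pd i g) x.
  by near: x; exact: germ_fun_sum.
apply: eq_bigr => i _; move: i; near: x.
exact: filter_forall.
Unshelve. all: by end_near. Qed.

Lemma germ_vector_field_derivation xi :
  is_derivation germ_cst (germ_vector_field xi).
Proof.
have near_pdE (a b : 'rV[R]_n -> R) i :
    (\forall x \near (0 : 'rV[R]_n), a x = b x) ->
    \forall x \near (0 : 'rV[R]_n), pd i a x = pd i b x.
  move=> /nbhs_interior ab; near=> x; apply: near_eq_derive.
  by near: x.
have derg i g : \forall x \near (0 : 'rV[R]_n),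
    derivable (germ_fun g) x (delta_mx 0 i).
  have [U oU sU] := germ_funP g.
  have : nbhs (0 : 'rV[R]_n) U by apply: open_nbhs_nbhs.
  by apply: filterS => x Ux; exact: (sU [::] x Ux).2.
have pdD i : {morph germ_pd i : a b / a + b}.
  move=> a b; apply/eq_germP.
  have H1 := near_pdE _ _ i (germ_funD a b).
  near=> x.
  have -> : germ_fun (germ_pd i (a + b)) x = pd i (germ_fun (a + b)) x.
    by near: x; exact: germ_fun_pd.
  have -> : germ_fun (germ_pd i a + germ_pd i b) x =
    germ_fun (germ_pd i a) x + germ_fun (germ_pd i b) x.
    by near: x; exact: germ_funD.
  have -> : germ_fun (germ_pd i a) x = pd i (germ_fun a) x.
    by near: x; exact: germ_fun_pd.
  have -> : germ_fun (germ_pd i b) x = pd i (germ_fun b) x.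
    by near: x; exact: germ_fun_pd.
  have -> : pd i (germ_fun (a + b)) x =
    pd i (germ_fun a \+ germ_fun b) x by near: x.
  have [da db] : derivable (germ_fun a) x (delta_mx 0 i) /\
      derivable (germ_fun b) x (delta_mx 0 i).
    by near: x; exact: filterI (derg i a) (derg i b).
  by rewrite /pd (deriveD da db).
have pdM i a b : germ_pd i (a * b) = germ_pd i a * b + a * germ_pd i b.
  apply/eq_germP.
  have H1 := near_pdE _ _ i (germ_funM a b).
  near=> x.
  have -> : germ_fun (germ_pd i (a * b)) x = pd i (germ_fun (a * b)) x.
    by near: x; exact: germ_fun_pd.
  have -> : germ_fun (germ_pd i a * b + a * germ_pd i b) x =
    germ_fun (germ_pd i a * b) x + germ_fun (a * germ_pd i b) x.
    by near: x; exact: germ_funD.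
  have -> : germ_fun (germ_pd i a * b) x =
    germ_fun (germ_pd i a) x * germ_fun b x by near: x; exact: germ_funM.
  have -> : germ_fun (a * germ_pd i b) x =
    germ_fun a x * germ_fun (germ_pd i b) x by near: x; exact: germ_funM.
  have -> : germ_fun (germ_pd i a) x = pd i (germ_fun a) x.
    by near: x; exact: germ_fun_pd.
  have -> : germ_fun (germ_pd i b) x = pd i (germ_fun b) x.
    by near: x; exact: germ_fun_pd.
  have -> : pd i (germ_fun (a * b)) x =
    pd i (germ_fun a \* germ_fun b) x by near: x.
  have [da db] : derivable (germ_fun a) x (delta_mx 0 i) /\
      derivable (germ_fun b) x (delta_mx 0 i).
    by near: x; exact: filterI (derg i a) (derg i b).
  by rewrite /pd (deriveM da db) addrC [X in X + _]mulrC.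
have pdc i k : germ_pd i (germ_cst k) = 0.
  have -> : 0 = germ_cst 0 :> germ R n.
    have -> : germ_cst 0 = \pi_(germ R n) 0 by congr (\pi _); exact: val_inj.
    by rewrite (@pi_zeror _ _ _ _ _ (germ R n)).
  apply/eq_germP.
  have H1 := near_pdE _ _ i (germ_fun_cst k).
  near=> x.
  have -> : germ_fun (germ_cst 0) x = 0 by near: x; exact: germ_fun_cst.
  have -> : germ_fun (germ_pd i (germ_cst k)) x =
    pd i (germ_fun (germ_cst k)) x by near: x; exact: germ_fun_pd.
  have -> : pd i (germ_fun (germ_cst k)) x = pd i (cst k) x by near: x.
  by rewrite /pd derive_cst.
rewrite /germ_vector_field; split=> [a b|k a|a b].
- by rewrite -big_split/=; apply: eq_bigr => i _; rewrite pdD mulrDr.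
- rewrite mulr_sumr; apply: eq_bigr => i _.
  by rewrite pdM pdc mul0r add0r mulrCA.
- rewrite mulr_suml mulr_sumr -big_split/=; apply: eq_bigr => i _.
  by rewrite pdM mulrDr mulrA mulrCA.
Unshelve. all: by end_near. Qed.

End GermTheory.

Section ZeroLocus.
Context {R : realType} {n : nat}.
Implicit Types (Z : set 'rV[R]_n) (J : {pred germ R n}).

Definition set_germ_le Z Z' : Prop :=
  \forall x \near (0 : 'rV[R]_n), Z x -> Z' x.

Definition set_germ_eq Z Z' : Prop :=
  \forall x \near (0 : 'rV[R]_n), Z x <-> Z' x.

Definition vanishes_on (g : germ R n) Z : Prop :=
  \forall x \near (0 : 'rV[R]_n), Z x -> germ_fun g x = 0.

(* Z represents V(J): it is the largest germ of a closed set on which every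
   element of J vanishes.  For J generated by g_1, ..., g_k this is the germ of
   their common zero set.  For a J that is not finitely generated one cannot
   instead intersect the zero sets of chosen representatives: the neighborhoods
   on which they are meaningful may shrink to the origin. *)
Definition zero_germ J Z : Prop :=
  [/\ closed Z,
      forall g, g \in J -> vanishes_on g Z
    & forall Z', closed Z' -> (forall g, g \in J -> vanishes_on g Z') ->
        set_germ_le Z' Z].

End ZeroLocus.

Definition quot_cst (R : realType) (n : nat) (J : idealr (germ R n)) (c : R) :
  {ideal_quot J} := \pi_{ideal_quot J} (germ_cst c).

(* Main.v *)
Require Import Defs.
From mathcomp Require Import all_boot all_order all_algebra.
From mathcomp Require Import generic_quotient ring_quotient.
From mathcomp Require Import ring lra.
From mathcomp Require Import all_classical all_reals all_analysis.
Import Order.TTheory GRing.Theory Num.Theory.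
Import numFieldNormedType.Exports.

Set Implicit Arguments.
Unset Strict Implicit.
Unset Printing Implicit Defensive.

Local Open Scope classical_set_scope.
Local Open Scope ring_scope.
Local Open Scope quotient_scope.

(* Pick a coordinate [x_i] whose coefficient [xi_i] does not vanish on [Z] and
   points [z_d] of [Z] tending to the origin with [xi_i (z_d) <> 0]. A function
   [h \o x_i] of that single coordinate suffices:
   [xi^j (h \o x_i) (z_d) = \sum_(m <= j) P j m (z_d) * h^(m) (x_i (z_d))] has
   leading coefficient [P j j (z_d) = xi_i (z_d) ^+ j <> 0]. A gliding hump
   argument produces [h]: it is a lacunary series of sine waves, the [l]-th one
   having frequency so high that it makes the term of order [l.+1] of the
   exponential series at one given point large, and amplitude so small that it
   neither spoils the earlier terms nor the smoothness of the sum; it is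
   omitted when the sum of the previous waves already makes that term large.
   Each point is visited infinitely often, so that at no [z_d] do the terms of
   the series tend to 0. *)

(** * Lacunary sums of sine waves and their derivatives *)

Section TrigonometricSeries.
Context {R : realType}.

(** Increments of either sign are allowed, and the bound on [c] permits a second application to the
    increment [c - x]. *)
Lemma mvt_total (f df : R -> R) (x b : R) :
  (forall y : R, is_derive y 1 f (df y)) ->
  exists2 c, `|c - x| <= `|b| & f (x + b) - f x = df c * b.
Proof.
move=> fdf; have fc p q : {within `[p, q], continuous f}.
  by apply: derivable_within_continuous => y _; have [] := fdf y.
have [b0|b0] := leP 0 b.
  have xb : x <= x + b by rewrite lerDl.
  have [c] := MVT_segment xb (fun y _ => fdf y) (@fc _ _).
  rewrite in_itv/= => /andP[xc cb] ->; exists c; last by congr (_ * _); ring.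
  by rewrite !ger0_norm ?subr_ge0// lerBlDl.
have xb : x + b <= x by rewrite gerDl ltW.
have [c] := MVT_segment xb (fun y _ => fdf y) (@fc _ _).
rewrite in_itv/= => /andP[xc cb] e; exists c.
  by rewrite ler0_norm ?subr_le0// ltr0_norm//; lra.
by rewrite -[LHS]opprK opprB e; ring.
Qed.

(** Mean value theorem for [sin], then for [cos]. *)
Lemma sin_taylor2 (x b : R) : `|sin (x + b) - sin x - b * cos x| <= b ^+ 2.
Proof.
have [c cx ->] := mvt_total x b (@is_derive_sin R).
have [c' _] := mvt_total x (c - x) (@is_derive_cos R).
rewrite [x + _]addrC subrK => e.
have -> : cos c * b - b * cos x = - sin c' * (c - x) * b by rewrite -e; ring.
rewrite !normrM normrN expr2 -[leRHS]ger0_norm ?sqr_ge0// normrM.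
apply: ler_pM => //.
by rewrite -[leRHS]mul1r ler_pM// sin_max.
Qed.

(** Termwise differentiation at [t]: the summed Taylor remainders stay quadratic in [u], so the
    difference quotient errs by [O(|u|)]. *)
Lemma is_derive_limn_series (f : nat -> R -> R) (df B : nat -> R) (t : R) :
  (forall s, cvgn (series (f ^~ s))) -> cvgn (series df) -> cvgn (series B) ->
  (forall l u, `|f l (t + u) - f l t - u * df l| <= B l * u ^+ 2) ->
  is_derive t 1 (fun s => limn (series (f ^~ s))) (limn (series df)).
Proof.
move=> cf cdf cB fB; set S := fun s => _.
pose F (s : R) : R^nat := f ^~ s.
have quad u : `|S (t + u) - S t - u * limn (series df)| <=
    limn (series B) * u ^+ 2.
  have c1 : cvgn (series (F (t + u) - F t)) := is_cvg_seriesB (cf _) (cf _).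
  have c2 : cvgn (series (u *: (df : R^nat))) := is_cvg_seriesZ cdf.
  have -> : S (t + u) - S t - u * limn (series df) =
      limn (series (F (t + u) - F t - u *: (df : R^nat))).
    rewrite lim_seriesB// lim_seriesB ?lim_seriesZ//; exact: cf.
  have cu2 : cvgn (series (u ^+ 2 *: (B : R^nat))) := is_cvg_seriesZ cB.
  have cn : cvgn [normed series (F (t + u) - F t - u *: (df : R^nat))].
    apply: (series_le_cvg _ _ _ cu2) => l; first exact: normr_ge0.
      rewrite [leRHS]mulrC; exact: le_trans (fB l u).
    by rewrite [leRHS]mulrC; exact: fB.
  apply: (le_trans (lim_series_norm cn)).
  rewrite [leRHS]mulrC -[leRHS](lim_seriesZ _ cB); apply: lim_series_le => // l.
  by rewrite [leRHS]mulrC; exact: fB.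
have lim0 : (fun h => h^-1 *: (S (h *: (1 : R) + t) - S t)) @ 0^' -->
    limn (series df).
  apply/subr_cvg0.
  apply: (@cvg_to_0_linear _ _ (limn (series B)) 1) => // r /andP[r0 _].
  have rn0 : r != 0 by rewrite -normr_gt0.
  rewrite /= /GRing.scale/= mulr1 addrC [r + t]addrC.
  have -> : - limn (series df) + r^-1 * (S (t + r) - S t) =
      r^-1 * (S (t + r) - S t - r * limn (series df)).
    by rewrite [RHS]mulrBr mulKf// addrC.
  rewrite normrM normfV ler_pdivrMl// (le_trans (quad r))//.
  by rewrite -[r ^+ 2]real_normK ?num_real// expr2 mulrA [leRHS]mulrC.
have dS : derivable S t 1 by apply/cvg_ex; exists (limn (series df)).
by apply: DeriveDef => //; exact: cvg_lim lim0.
Qed.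

(* The [m]-th derivative of [t |-> a * sin (w * t + p)]. *)
Definition sinwave (a w p : R) (m : nat) (t : R) : R :=
  a * w ^+ m * sin (w * t + p + pi / 2 *+ m).

Lemma normr_sinwave a w p m t : `|sinwave a w p m t| <= `|a| * `|w| ^+ m.
Proof. by rewrite !normrM normrX ler_piMr ?sin_max// mulr_ge0// exprn_ge0. Qed.

(** A phase shift by [pi / 2] turns sine into cosine, so raising [m] differentiates; the estimate is
    [sin_taylor2] with increment [w * u]. *)
Lemma sinwave_taylor2 a w p m t u :
  `|sinwave a w p m (t + u) - sinwave a w p m t - u * sinwave a w p m.+1 t|
    <= `|a| * `|w| ^+ m.+2 * u ^+ 2.
Proof.
rewrite /sinwave [pi / 2 *+ _.+1]mulrSr [w * t + p + (_ + _)]addrA sinDpihalf.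
set x := w * t + _ + _; have -> : w * (t + u) + p + pi / 2 *+ m = x + w * u.
  by rewrite /x; ring.
have -> : a * w ^+ m * sin (x + w * u) - a * w ^+ m * sin x
    - u * (a * w ^+ m.+1 * cos x) =
  a * w ^+ m * (sin (x + w * u) - sin x - w * u * cos x) by rewrite exprS; ring.
have -> : `|a| * `|w| ^+ m.+2 * u ^+ 2 = `|a| * `|w| ^+ m * (w * u) ^+ 2.
  by rewrite exprMn -[w ^+ 2]real_normK ?num_real// -[m.+2]addn2 exprD; ring.
rewrite !(normrM, normrX) ler_wpM2l ?sin_taylor2//.
Qed.

Definition wavesum (a w p : nat -> R) (m : nat) (t : R) : R :=
  limn (series (fun l => sinwave (a l) (w l) (p l) m t)).

Lemma is_cvg_wavesum (a w p : R^nat) m t :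
  cvgn (series (fun l => `|a l| * `|w l| ^+ m)) ->
  cvgn (series (fun l => sinwave (a l) (w l) (p l) m t)).
Proof.
move=> aw; apply: normed_cvg; apply: (series_le_cvg _ _ _ aw) => l /=.
- exact: normr_ge0.
- by rewrite mulr_ge0// exprn_ge0.
- exact: normr_sinwave.
Qed.

Lemma is_derive_wavesum (a w p : R^nat) m (t : R) :
  (forall k, cvgn (series (fun l => `|a l| * `|w l| ^+ k))) ->
  is_derive t 1 (wavesum a w p m) (wavesum a w p m.+1 t).
Proof.
move=> aw.
have Bc : cvgn (series (fun l => `|a l| * `|w l| ^+ m.+2)) by exact: aw.
apply: (is_derive_limn_series _ _ Bc) => [s||l u]; last exact: sinwave_taylor2.
- exact: is_cvg_wavesum.
- exact: is_cvg_wavesum.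
Qed.

(** Task [l] is a linear form on the jet of order [l.+1] at [tau l]. As its top coefficient is
    nonzero, a fast wave acts on it mainly through its highest derivative. *)
Lemma exists_jets_large (tau : nat -> R) (L : nat -> nat -> R) :
  (forall l, L l l.+1 != 0) ->
  exists h : nat -> R -> R,
    (forall m (s : R), is_derive s 1 (h m) (h m.+1 s)) /\
    forall l, 1 <= `|\sum_(m < l.+2) L l m * h m (tau l)|.
Proof.
move=> L0.
(* The [n]-th wave has derivatives of order [m <= n] of size at most
   [(2 ^+ n)^-1 / M n], hence moves the task [l < n] by at most [(2 ^+ n)^-1];
   its derivative of order [n.+1] has size [w n / (M n * 2 ^+ n)], and [w n]
   is chosen so that this dominates the task [n]. *)
pose B l : R := \sum_(m < l.+2) `|L l m|.
pose M l : R := 1 + \sum_(k < l.+1) B k.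
(* Of the 5, lower-order terms cost at most 1; the other 4 still leave 2 against an earlier sum
   below 2. The summand 1 makes the powers of [w l] nondecreasing. *)
pose w l : R := 1 + 5 * M l * 2 ^+ l / `|L l l.+1|.
pose c l : R := (M l * 2 ^+ l * w l ^+ l)^-1.
(* At [tau l] the argument of the derivative of order [l.+1] becomes [pi / 2], where the sine is
   1. *)
pose p l : R := pi / 2 - pi / 2 *+ l.+1 - w l * tau l.
pose T l (g : nat -> R -> R) := \sum_(m < l.+2) L l m * g m (tau l).
pose e l (g : nat -> R -> R) : R := if 2 <= `|T l g| then 0 else 1.
(* Whether a wave is kept depends on the sum of the earlier ones, so the partial sums come first and
   the amplitudes [a] are read off them. *)
pose fix H l : nat -> R -> R := if l is k.+1 then
    fun m s => H k m s + sinwave (e k (H k) * c k) (w k) (p k) m s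
  else fun _ _ => 0.
pose a l := e l (H l) * c l.
have HE n m s : H n m s = series (fun l => sinwave (a l) (w l) (p l) m s) n.
  elim: n => [|n IH]; first by rewrite /series/= big_geq.
  by rewrite seriesSr -IH.
have B0 l : 0 <= B l by exact: sumr_ge0.
have BM k l : (k <= l)%N -> B k <= M l.
  move=> kl; rewrite /M (bigD1 (Ordinal (kl : (k < l.+1)%N)))//=.
  by rewrite addrCA lerDl addr_ge0// sumr_ge0.
have M1 l : 1 <= M l by rewrite lerDl sumr_ge0.
have M0 l : 0 < M l := lt_le_trans ltr01 (M1 l).
have p0 l : 0 < 2 ^+ l :> R by exact: exprn_gt0.
have w1 l : 1 <= w l.
  by rewrite lerDl divr_ge0// !mulr_ge0// ?ltW.
have w0 l : 0 < w l := lt_le_trans ltr01 (w1 l).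
have c0 l : 0 < c l by rewrite invr_gt0 !mulr_gt0// exprn_gt0.
have cw l m : (m <= l)%N -> c l * w l ^+ m <= (M l)^-1 * (2 ^+ l)^-1.
  move=> ml; rewrite /c 2!invfM -[leLHS]mulrA ler_piMr//.
    by rewrite mulr_ge0// invr_ge0 ltW.
  by rewrite ler_pdivrMl ?exprn_gt0// mulr1 ler_weXn2l.
have ac l : `|a l| <= c l.
  rewrite normrM (gtr0_norm (c0 l)) ger_pMl//.
  by rewrite /e; case: ifP; rewrite ?normr0 ?normr1.
have Tadd l g1 g2 : T l (fun m s => g1 m s + g2 m s) = T l g1 + T l g2.
  by rewrite /T -big_split; apply: eq_bigr => m _; rewrite mulrDr.
have Tsmall l n b : (l < n)%N -> `|b| <= c n ->
    `|T l (sinwave b (w n) (p n))| <= (2 ^+ n)^-1.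
  move=> ln bc; apply: (le_trans (ler_norm_sum _ _ _)).
  apply: (@le_trans _ _ (\sum_(m < l.+2) `|L l m| * ((M n)^-1 * (2 ^+ n)^-1))).
    apply: ler_sum => m _; rewrite normrM ler_wpM2l//.
    apply: (le_trans (normr_sinwave _ _ _ _ _)); rewrite (gtr0_norm (w0 n)).
    apply: le_trans (cw n m _); last by rewrite (leq_trans _ ln)// -ltnS.
    by rewrite ler_wpM2r// exprn_ge0// ltW.
  rewrite -mulr_suml -/(B l) mulrA ler_piMl ?invr_ge0 ?(ltW (p0 n))//.
  by rewrite ler_pdivrMr// mul1r BM// ltnW.
have Tbig l : 4 <= `|T l (sinwave (c l) (w l) (p l))|.
  rewrite /T big_ord_recr/=.
  have -> : sinwave (c l) (w l) (p l) l.+1 (tau l) = c l * w l ^+ l.+1.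
    by rewrite /sinwave /p [X in sin X](_ : _ = pi / 2);
      [rewrite sin_pihalf mulr1|ring].
  set S := \sum_(m < l.+1) _.
  have S1 : `|S| <= 1.
    apply: (le_trans (ler_norm_sum _ _ _)).
    apply: (@le_trans _ _ (\sum_(m < l.+1) `|L l m| * (M l)^-1)).
      apply: ler_sum => m _; rewrite normrM ler_wpM2l//.
      apply: (le_trans (normr_sinwave _ _ _ _ _)).
      rewrite (gtr0_norm (w0 l)) (gtr0_norm (c0 l)).
      apply: (le_trans (cw l m _)); first by rewrite -ltnS.
      rewrite ler_piMr ?invr_ge0 ?(ltW (M0 l))// invf_le1// exprn_ege1//.
      by rewrite ler1n.
    rewrite -mulr_suml ler_pdivrMr// mul1r (le_trans _ (BM l l _))//.
    by rewrite /B [leRHS]big_ord_recr lerDl.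
  have lead : 5 <= `|L l l.+1 * (c l * w l ^+ l.+1)|.
    rewrite normrM (gtr0_norm (mulr_gt0 (c0 l) (exprn_gt0 _ (w0 l)))).
    have Lgt0 : 0 < `|L l l.+1| by rewrite normr_gt0.
    have -> : c l * w l ^+ l.+1 = (M l * 2 ^+ l)^-1 * w l.
      rewrite /c exprS; field.
      by rewrite !gt_eqF// exprn_gt0.
    rewrite mulrCA ler_pdivlMl ?mulr_gt0//.
    have -> : `|L l l.+1| * w l = `|L l l.+1| + M l * 2 ^+ l * 5.
      by rewrite /w; field; rewrite gt_eqF.
    by rewrite lerDr ltW.
  have := ler_normB (S + L l l.+1 * (c l * w l ^+ l.+1)) S.
  by rewrite [S + _]addrC addrK; lra.
have T2 l : 2 <= `|T l (H l.+1)|.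
  rewrite /= /e; have [T2|T2] := leP 2 `|T l (H l)|.
    rewrite Tadd mul0r (_ : T l (sinwave _ _ _) = 0) ?addr0//.
    by apply: big1 => m _; rewrite /sinwave !mul0r mulr0.
  rewrite Tadd mul1r.
  have := ler_normB (T l (H l) + T l (sinwave (c l) (w l) (p l))) (T l (H l)).
  by rewrite [T l (H l) + _]addrC addrK; have := Tbig l; lra.
(* The margin over 1 halves at each step: the next wave takes away at most half of what is left. *)
have Tfar l n : 1 + (2 ^+ (l + n))^-1 <= `|T l (H (l.+1 + n)%N)|.
  elim: n => [|n IH].
    rewrite !addn0 (le_trans _ (T2 l))// lerD2l invf_le1// exprn_ege1//.
    by rewrite ler1n.
  rewrite !addnS -addSn; rewrite [H (_ + n).+1]/= Tadd.
  have := @Tsmall l (l.+1 + n)%N _ (leq_addr _ _) (ac (l.+1 + n)%N).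
  rewrite -/(a (l.+1 + n)%N); set X := T l _; set Y := T l _ => Y1.
  have := ler_normB (X + Y) X; rewrite [X + Y]addrC addrK => XY.
  have : (2 ^+ (l + n))^-1 = 2 * (2 ^+ (l.+1 + n))^-1 :> R.
    by rewrite addSn exprS; field; rewrite gt_eqF.
  move: IH Y1 XY; rewrite -/Y [Y + X]addrC; lra.
have aw m : cvgn (series (fun l => `|a l| * `|w l| ^+ m)).
  (* [cw] controls the terms with [l >= m]; the finitely many earlier ones are absorbed in [K]. *)
  pose K := 1 + \sum_(k < m) `|a k| * `|w k| ^+ m * 2 ^+ k.
  have gc : cvgn (series (geometric K (2^-1 : R))).
    by apply: is_cvg_geometric_series; rewrite gtr0_norm// invf_lt1// ltr1n.
  have K1 : 1 <= K.
    by rewrite lerDl sumr_ge0// => k _; rewrite !mulr_ge0// exprn_ge0.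
  apply: (series_le_cvg _ _ _ gc) => l.
  - by rewrite mulr_ge0// exprn_ge0.
  - by rewrite /= mulr_ge0 ?exprn_ge0// (le_trans ler01).
  rewrite /= exprVn ler_pdivlMr//.
  have [ml|lm] := leqP m l; last first.
    rewrite /K (bigD1 (Ordinal lm))//= addrCA lerDl addr_ge0// sumr_ge0//.
  apply: le_trans K1; rewrite -ler_pdivlMr// mul1r (gtr0_norm (w0 l)).
  apply: (@le_trans _ _ (c l * w l ^+ m)).
    by rewrite ler_wpM2r// exprn_ge0// ltW.
  apply: (le_trans (cw l m ml)).
  by rewrite ler_piMl ?invr_ge0 ?(ltW (p0 l))// invf_le1.
exists (wavesum a w p); split=> [m s|l]; first exact: is_derive_wavesum.
(* A task involves finitely many derivatives, so its value passes to the limit of the partial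
   sums. *)
have Tcvg : (fun n => T l (H n)) @ \oo --> T l (wavesum a w p).
  apply: cvg_big => [|m _]; first exact: add_continuous.
  apply: cvgMl_tmp; under eq_fun do rewrite HE.
  exact: is_cvg_wavesum.
apply: (cvgr_to_ge (cvg_norm Tcvg)); exists l.+1 => // n /= ln.
rewrite -(subnKC ln) (le_trans _ (Tfar _ _))// lerDl invr_ge0 ltW//.
Qed.

(** Stage [l] treats order [l.+1], so a schedule returning to each [d] infinitely often reaches
    arbitrarily high orders there. *)
Lemma exists_jets_unbounded (t : nat -> R) (A : nat -> nat -> nat -> R) :
  (forall d j, A d j j != 0) ->
  exists h : nat -> R -> R,
    (forall m (s : R), is_derive s 1 (h m) (h m.+1 s)) /\
    forall d N, exists2 j, (N <= j)%N &
      1 <= `|\sum_(m < j.+1) A d j m * h m (t d)|.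
Proof.
move=> A0.
(* The task [d] comes back at every stage [l] such that [l.+1 = 2 ^ d * odd]. *)
pose d l := logn 2 l.+1.
have [h [dh hT]] := @exists_jets_large (t \o d) (fun l => A (d l) l.+1)
  (fun l => A0 _ _).
exists h; split=> // d0 N.
have d0E : d (2 ^ d0 * N.*2.+1).-1 = d0.
  rewrite /d prednK ?muln_gt0 ?expn_gt0// lognM ?expn_gt0// pfactorK//.
  by rewrite lognE dvdn2 /= odd_double addn0.
have := hT (2 ^ d0 * N.*2.+1).-1; rewrite /= d0E prednK ?muln_gt0 ?expn_gt0//.
move=> hN; exists (2 ^ d0 * N.*2.+1)%N => //.
by rewrite (leq_trans _ (leq_pmull _ _)) ?expn_gt0// -addnn -addnS leq_addr.
Qed.

End TrigonometricSeries.

(** * Algebra and locality of vector fields on smooth functions *)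

Section VectorField.
Context {R : realType} {n : nat}.
Implicit Types (f g : 'rV[R]_n -> R) (X : 'I_n -> 'rV[R]_n -> R)
  (U W : set 'rV[R]_n).

Lemma smooth_on_sum {I : Type} (r : seq I) U (F : I -> 'rV[R]_n -> R) :
  open U -> (forall i, smooth_on U (F i)) ->
  smooth_on U (fun x => \sum_(i <- r) F i x).
Proof.
move=> oU sF; elim: r => [|i r IH].
  have -> : (fun x => \sum_(i <- [::]) F i x) = cst 0.
    by apply/funext => x; rewrite big_nil.
  exact: smooth_on_cst.
have -> : (fun x => \sum_(j <- i :: r) F j x) =
    F i \+ (fun x => \sum_(j <- r) F j x).
  by apply/funext => x; rewrite big_cons.
exact: smooth_onD oU (sF i) IH.
Qed.

Lemma smooth_on_vector_field U X f : open U ->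
  (forall i, smooth_on U (X i)) -> smooth_on U f ->
  smooth_on U (vector_field X f).
Proof.
move=> oU sX sf; apply: smooth_on_sum => // i.
exact: smooth_onM oU (sX i) (smooth_on_pd i sf).
Qed.

Lemma vector_field_eq_on U X Y f g : open U ->
  (forall i, {in U, X i =1 Y i}) -> {in U, f =1 g} ->
  {in U, vector_field X f =1 vector_field Y g}.
Proof.
move=> oU XY fg x xU; apply: eq_bigr => i _.
by rewrite XY// (pd_eq_on i oU fg xU).
Qed.

(** This locality transfers the expansion for chosen representatives to arbitrary ones near the
    origin. *)
Lemma iter_vector_field_eq_on U X Y f g j : open U ->
  (forall i, {in U, X i =1 Y i}) -> {in U, f =1 g} ->
  {in U, iter j (vector_field X) f =1 iter j (vector_field Y) g}.
Proof.
move=> oU XY fg; elim: j => //= j IH.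
exact: vector_field_eq_on.
Qed.

Lemma vector_field_sum {I : Type} (r : seq I) U X (F : I -> 'rV[R]_n -> R) x :
  open U -> U x -> (forall i, smooth_on U (F i)) ->
  vector_field X (fun y => \sum_(i <- r) F i y) x =
  \sum_(i <- r) vector_field X (F i) x.
Proof.
move=> oU Ux sF; rewrite [RHS]exchange_big/=; apply: eq_bigr => k _.
rewrite -mulr_sumr; congr (_ * _); elim: r => [|i r IH].
  rewrite /pd (_ : (fun y => _) = cst 0) ?derive_cst ?big_nil//.
  by apply/funext => y; rewrite big_nil.
rewrite big_cons -IH /pd -deriveD.
- by congr ('D__ _ x); apply/funext => y; rewrite big_cons.
- exact: (sF i [::] x Ux).2.
- exact: (@smooth_on_sum _ r _ _ oU sF [::] x Ux).2.
Qed.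

Lemma vector_fieldM U X f g x : U x -> smooth_on U f -> smooth_on U g ->
  vector_field X (f \* g) x =
    vector_field X f x * g x + f x * vector_field X g x.
Proof.
move=> Ux sf sg; rewrite mulr_suml mulr_sumr -big_split; apply: eq_bigr => k _.
rewrite /pd (deriveM ((sf [::] x Ux).2 k) ((sg [::] x Ux).2 k))/=.
by rewrite /GRing.scale/=; ring.
Qed.

(** * Vector fields applied to functions of one coordinate *)

Section Coordinate.
Variables (i : 'I_n) (h : nat -> R -> R).
Hypothesis dh : forall m (s : R), is_derive s 1 (h m) (h m.+1 s).

Definition coord_jet m : 'rV[R]_n -> R := fun x => h m (x 0 i).

Lemma is_derive_coord m k (x : 'rV[R]_n) :
  is_derive x (delta_mx 0 k) (coord_jet m) ((k == i)%:R * coord_jet m.+1 x).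
Proof.
have [->|ki] := eqVneq k i; rewrite ?mul1r ?mul0r.
  have [dhx e] := dh m (x 0 i).
  have -> : coord_jet m.+1 x = 'D_1 (h m) (x 0 i) by rewrite e.
  have E : (fun u : R => u^-1 *:
      ((coord_jet m \o shift x) (u *: delta_mx 0 i) - coord_jet m x))
    = (fun u : R => u^-1 *: ((h m \o shift (x 0 i)) (u *: 1) - h m (x 0 i))).
    by apply/funext => u; rewrite /coord_jet /= !mxE !eqxx.
  by apply: DeriveDef; rewrite /derivable /derive E.
have E : (fun u : R => u^-1 *:
      ((coord_jet m \o shift x) (u *: delta_mx 0 k) - coord_jet m x))
    = cst 0.
  apply/funext => u; rewrite /coord_jet /= !mxE eqxx eq_sym (negPf ki).
  by rewrite mulr0 add0r subrr scaler0.
apply: DeriveDef; rewrite /derivable /derive E; first exact: is_cvg_cst.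
exact: lim_cst.
Qed.

Lemma pds_coord s m : pds s (coord_jet m) =
  (fun x => (all (pred1 i) s)%:R * coord_jet (m + size s) x).
Proof.
elim: s => [|k s IH]; first by apply/funext => x; rewrite /= addn0 mul1r.
apply/funext => x; rewrite /= IH /pd.
have [dH e] := is_derive_coord (m + size s) k x.
rewrite [LHS](_ : _ = 'D_(delta_mx 0 k)
  ((all (pred1 i) s)%:R *: coord_jet (m + size s)) x)// deriveZ// e addnS.
by rewrite /GRing.scale/= mulrA mulrC -natrM mulnb mulrC andbC.
Qed.

Lemma smooth_on_coord U m : smooth_on U (coord_jet m).
Proof.
move=> s x Ux; rewrite pds_coord; split.
  have cH : {for x,
      continuous (h (m + size s)%N \o (fun y : 'rV[R]_n => y 0 i))}.
    apply: continuous_comp; first exact: coord_continuous.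
    apply: differentiable_continuous; apply/derivable1_diffP.
    by have [] := dh (m + size s) (x 0 i).
  apply: continuousM; [exact: cst_continuous|exact: cH].
move=> k; apply: (@derivableZ _ _ _ (coord_jet (m + size s))).
by have [] := is_derive_coord (m + size s) k x.
Qed.

Lemma vector_field_coord X m x :
  vector_field X (coord_jet m) x = X i x * coord_jet m.+1 x.
Proof.
have pdH k : pd k (coord_jet m) x = (k == i)%:R * coord_jet m.+1 x.
  by have [_] := is_derive_coord m k x.
rewrite /vector_field (bigD1 i)//= big1 ?addr0 => [|k /negPf ki].
  by rewrite pdH eqxx mul1r.
by rewrite pdH ki mul0r mulr0.
Qed.

(* Coefficients of the expansion
   [xi^j (h \o x_i) = \sum_(m <= j) coef j m * (h^(m) \o x_i)]. *)
Fixpoint coef X j m : 'rV[R]_n -> R :=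
  match j with
  | 0%N => cst (m == 0)%:R
  | j'.+1 => vector_field X (coef X j' m) \+
      (if m is m'.+1 then X i \* coef X j' m' else cst 0)
  end.

Lemma vector_field_cst X c : vector_field X (cst c) = cst 0.
Proof.
by apply/funext => x; apply: big1 => k _; rewrite /pd derive_cst mulr0.
Qed.

Lemma coef_gt X j m : (j < m)%N -> coef X j m = cst 0.
Proof.
elim: j m => [|j IH] [|m]//= jm.
rewrite IH 1?ltnW// IH// vector_field_cst.
by apply/funext => x /=; rewrite mulr0 addr0.
Qed.

(** In the recursion the differentiated coefficient lies above the diagonal and vanishes, so each
    step only multiplies by [X i]. *)
Lemma coef_diag X j x : coef X j j x = X i x ^+ j.
Proof.
elim: j => [|j IH]//=.
by rewrite coef_gt// vector_field_cst add0r IH exprS.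
Qed.

Lemma smooth_on_coef W X j m : open W -> (forall k, smooth_on W (X k)) ->
  smooth_on W (coef X j m).
Proof.
move=> oW sX; elim: j m => [|j IH] m /=; first exact: smooth_on_cst.
apply: smooth_onD => //; first exact: smooth_on_vector_field.
by case: m => [|m]; [exact: smooth_on_cst|exact: smooth_onM].
Qed.

(** By the Leibniz rule, differentiating a coefficient keeps [m] while differentiating the jet
    raises it, as in the recursion for [coef]. *)
Lemma iter_vector_field_coord W X j : open W -> (forall k, smooth_on W (X k)) ->
  {in W, forall x, iter j (vector_field X) (coord_jet 0) x =
    \sum_(m < j.+1) coef X j m x * coord_jet m x}.
Proof.
move=> oW sX; elim: j => [|j IH] x xW.
  by rewrite big_ord1/= mul1r.
have Wx : W x by rewrite inE in xW.
have sP (m : 'I_j.+1) : smooth_on W (coef X j m \* coord_jet m).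
  by apply: smooth_onM => //; [exact: smooth_on_coef|exact: smooth_on_coord].
rewrite iterS (@vector_field_eq_on W X X _ _ oW _ IH)//.
rewrite (@vector_field_sum _ _ W)//.
under eq_bigr => m _.
  rewrite (@vector_fieldM W)//; last 2 first.
  - exact: smooth_on_coef.
  - exact: smooth_on_coord.
  rewrite vector_field_coord; over.
(* On the right, each of the two sums has one extra term, equal to 0: the top one for the derived
   coefficients, the bottom one for the shifted products. *)
rewrite big_split/= [RHS](eq_bigr (fun m : 'I_j.+2 =>
  vector_field X (coef X j m) x * coord_jet m x +
  (if val m is m'.+1 then X i x * coef X j m' x else 0) *
    coord_jet m x)); last first.
  by move=> [[|m] ?] _ /=; rewrite mulrDl.
rewrite [RHS]big_split/=; congr (_ + _).
  by rewrite [RHS]big_ord_recr/= coef_gt// vector_field_cst mul0r addr0.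
rewrite [RHS]big_ord_recl/= mul0r add0r; apply: eq_bigr => m _.
by rewrite mulrCA mulrA.
Qed.

End Coordinate.
End VectorField.

(** * Divergence along points of the zero locus *)

Lemma exists_cvg_nonvanishing (R : realType) (n : nat) (g : germ R n)
    (Z W : set 'rV[R]_n) :
  ~ vanishes_on g Z -> nbhs (0 : 'rV[R]_n) W ->
  exists z : nat -> 'rV[R]_n,
    (forall d, [/\ W (z d), Z (z d) & germ_fun g (z d) != 0]) /\
    z @ \oo --> (0 : 'rV[R]_n).
Proof.
move=> gZ W0.
(* If no such point existed, [g] would vanish on [Z] within [W] and the ball. *)
have ex d : exists x : 'rV[R]_n,
    [/\ W x, Z x, germ_fun g x != 0 & ball (0 : 'rV[R]_n) d.+1%:R^-1 x].
  apply: contrapT => noz; apply: gZ.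
  have b0 : nbhs (0 : 'rV[R]_n) (ball (0 : 'rV[R]_n) d.+1%:R^-1).
    by apply: nbhsx_ballx; rewrite invr_gt0.
  apply: filterS (filterI W0 b0) => x [Wx bx] Zx.
  by apply: contrapT => /eqP gx; apply: noz; exists x.
have [z zP] := choice ex; exists z; split=> [d|]; first by have [] := zP d.
apply/cvg_ballP => e e0.
near=> d; have [_ _ _] := zP d; apply: le_ball; apply: ltW.
by near: d; exact: near_infty_natSinv_lt (PosNum e0).
Unshelve. all: by end_near. Qed.

Theorem theorem5p1 (R : realType) (n : nat)
    (J : idealr (germ R n)) (Z : set 'rV[R]_n)
    (xi : 'I_n -> germ R n) (xibar : {ideal_quot J} -> {ideal_quot J})
    (J_max : forall g : germ R n, g \in J -> germ_eval0 g = 0)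
    (VJ : zero_germ J Z)
    (VJ_neq : forall Z' : set 'rV[R]_n, set_germ_eq Z' Z ->
       exists x y, [/\ Z' x, Z' y & x <> y])
    (xibar_der : is_derivation (@quot_cst R n J) xibar)
    (xi_J : forall g : germ R n, g \in J -> germ_vector_field xi g \in J)
    (xi_xibar : forall g : germ R n,
       xibar (\pi_{ideal_quot J} g) = \pi_{ideal_quot J} (germ_vector_field xi g))
    (xi_neq0 : exists i, ~ vanishes_on (xi i) Z) :
  exists f : germ R n,
    forall (U : set 'rV[R]_n) (X : 'I_n -> 'rV[R]_n -> R) (F : 'rV[R]_n -> R),
      open_nbhs (0 : 'rV[R]_n) U ->
      (forall i, germ_rep U (X i) (xi i)) ->
      germ_rep U F f ->
      exists z : nat -> 'rV[R]_n,
        [/\ forall d, (U `&` Z) (z d),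
            z @ \oo --> (0 : 'rV[R]_n)
          & forall d, ~ cvgn (series
              (fun j => iter j (vector_field X) F (z d) / j`!%:R : R))].
Proof.
have [i xi_i] := xi_neq0.
pose X0 k := germ_fun (xi k).
have [W [W0 sX0]] : exists W : set 'rV[R]_n, open_nbhs (0 : 'rV[R]_n) W /\
    forall k, smooth_on W (X0 k).
  have /choice[V VP] : forall k, exists V, open_nbhs (0 : 'rV[R]_n) V /\
      smooth_on V (X0 k).
    by move=> k; have [V V0 sV] := germ_funP (xi k); exists V.
  have W0 : \forall x \near (0 : 'rV[R]_n), forall k, V k x.
    have Vk k : nbhs (0 : 'rV[R]_n) (V k).
      by apply: open_nbhs_nbhs; have [] := VP k.
    exact: filter_forall Vk.
  exists [set x | forall k, V k x]^°; split.
    by split; [exact: open_interior|exact: W0].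
  move=> k; have [_] := VP k; apply: smooth_onS => x.
  by move=> /nbhs_singleton; exact.
have oW : open W by case: W0.
(* The points are fixed before [f], by means of the representatives [X0]; for other representatives
   a tail of the sequence is used. *)
have [z [zP z0]] := exists_cvg_nonvanishing xi_i (open_nbhs_nbhs W0).
pose t d : R := z d 0 i.
pose A (d j m : nat) : R := coef i X0 j m (z d) / j`!%:R.
have A0 d j : A d j j != 0.
  have [_ _ xi_zd] := zP d.
  rewrite mulf_neq0 ?invr_eq0 ?pnatr_eq0 -?lt0n ?fact_gt0//.
  by rewrite coef_diag expf_neq0.
have [h [dh hA]] := exists_jets_unbounded t A0.
pose f0 := coord_jet i h 0 : 'rV[R]_n -> R.
have sf0 : smooth_near0 f0.
  exists setT; first by split; [exact: openT|].
  exact: (smooth_on_coord i dh).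
pose sf := SmoothFun (introT (smooth_near0_predP _) sf0).
pose f : germ R n := \pi_(germ R n) sf.
exists f => U X F U0 repX [sF Ff].
have V0 : nbhs (0 : 'rV[R]_n)
    [set x | [/\ U x, forall k, X k x = X0 k x & F x = f0 x]].
  have XX : \forall x \near (0 : 'rV[R]_n), forall k, X k x = X0 k x.
    have Xk k : \forall x \near (0 : 'rV[R]_n), X k x = X0 k x.
      by have [] := repX k.
    exact: filter_forall Xk.
  have ff := germ_fun_pi sf.
  near=> x; split.
  - by near: x; exact: open_nbhs_nbhs.
  - by near: x.
  - have -> : F x = germ_fun f x by near: x.
    by near: x; exact: ff.
set S := [set x | _] in V0; pose V : set 'rV[R]_n := S^°.
have oV : open V by exact: open_interior.
have VS : V `<=` S by exact: interior_subset.
have [N _ zV] : \forall d \near \oo, V (z d).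
  by apply: z0; apply: open_nbhs_nbhs; split.
(* The shift by [N] keeps only points of [V], where the given representatives agree with [X0] and
   [f0]. *)
exists (fun d => z (d + N)%N); split=> [d||d].
- have [Uz _ _] := VS _ (zV (d + N)%N (leq_addl _ _)).
  by split=> //; have [] := zP (d + N)%N.
- by rewrite cvg_shiftn.
set u := fun j => _.
have uE j : u j = \sum_(m < j.+1) A (d + N)%N j m * h m (t (d + N)%N).
  have zdV : z (d + N)%N \in V by rewrite inE; exact: zV (leq_addl _ _).
  have zdW : z (d + N)%N \in W.
    by rewrite inE; have [] := zP (d + N)%N.
  rewrite /u (@iter_vector_field_eq_on _ _ V X X0 F f0)//.
  - rewrite (iter_vector_field_coord i dh j oW sX0 zdW) mulr_suml.
    by apply: eq_bigr => m _; rewrite /A mulrAC.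
  - by move=> k x; rewrite inE => /VS[].
  - by move=> x; rewrite inE => /VS[].
(* Terms of a convergent series are eventually below 1 in absolute value, whereas [hA] gives terms
   of size at least 1 at arbitrarily high orders. *)
move=> /cvg_series_cvg_0 /cvgr0_norm_lt /(_ 1 ltr01)[M _ uM].
have [j Mj] := hA (d + N)%N M.
by rewrite -uE leNgt uM.
Unshelve. all: by end_near. Qed.
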